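(* Let $\alpha_0>0$, $\alpha_1\in\mathbb{R}$, $0<\gamma\notin\mathbb{N}$, $\tilde\alpha_0=\alpha_0/\cos(\frac{\pi}{2}\gamma)$, and $\alpha^*_{pl+}(\omega)=\tilde\alpha_0(-i\omega)^\gamma+\alpha_1(-i\omega)$ for $\omega\in\mathbb{R}$. Let $K(\vec x,t)=\frac{1}{\sqrt{2\pi}}\mathcal{F}^{-1}\{e^{-\alpha^*_{pl+}(\cdot)|\vec x|}\}(t)$. If $\gamma>1$, then $K$ is not causal. If $\gamma\in(0,1)$, then $K$ is causal if and only if $\alpha_1\in[0,\infty)$. *)

(* Defs.v *)
From Stdlib Require Import Reals Lra.
From Coquelicot Require Import Coquelicot.
Open Scope R_scope.

Definition abspow (w g : R) : R :=
  if Rlt_dec 0 (Rabs w) then Rpower (Rabs w) g else 0.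

(* Principal branch of (-i w)^g for real w:
   -i w = |w| e^{-i (pi/2) sgn w}, hence
   (-i w)^g = |w|^g (cos(pi g/2) - i sgn(w) sin(pi g/2)). *)
Definition sgnR (w : R) : R := if Rlt_dec 0 w then 1 else if Rlt_dec w 0 then -1 else 0.

Definition mi_pow (w g : R) : C :=
  (abspow w g * cos (PI * g / 2), - (sgnR w) * abspow w g * sin (PI * g / 2)).

Definition cexp (z : C) : C := (exp (fst z) * cos (snd z), exp (fst z) * sin (snd z)).

Definition alpha_pl (a0 a1 g w : R) : C :=
  Cplus (Cmult (RtoC (a0 / cos (PI * g / 2))) (mi_pow w g))
        (Cmult (RtoC a1) (0, - w)).

Definition norm3 (x : R * R * R) : R :=
  let '(x1, x2, x3) := x in sqrt (x1 ^ 2 + x2 ^ 2 + x3 ^ 2).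

(* Fourier convention: F{f}(w) = 1/sqrt(2 pi) int f(t) e^{i w t} dt,
   F^{-1}{g}(t) = 1/sqrt(2 pi) int g(w) e^{-i w t} dw.
   Integrand of K(x,t) = 1/sqrt(2 pi) F^{-1}{ e^{-alpha*(.) |x|} }(t): *)
Definition K_integrand (a0 a1 g : R) (x : R * R * R) (t w : R) : C :=
  Cmult (RtoC (/ (2 * PI)))
        (cexp (Cplus (Cmult (RtoC (- norm3 x)) (alpha_pl a0 a1 g w)) (0, - w * t))).

Definition K_is (a0 a1 g : R) (x : R * R * R) (t : R) (v : C) : Prop :=
  is_RInt_gen (K_integrand a0 a1 g x t)
              (Rbar_locally m_infty) (Rbar_locally p_infty) v.

Definition K_causal (a0 a1 g : R) : Prop :=
  forall (x : R * R * R) (t : R), x <> (0, 0, 0) -> t < 0 -> K_is a0 a1 g x t 0.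

(* Main.v *)
(** The integrand of [K(x,t)] is [f(w) = exp (- c (-i w)^g - i w s) / (2 pi)] with
    [c = |x| a0 / cos (pi g / 2)] and [s = t - |x| a1], and since
    [f(-w) = conj (f w)] only the real part of its integral over the positive
    half-line matters.  That half-line can be turned about the origin whenever
    [R |f(R e^(i th))|] tends to 0 on the arc swept.

    For [g < 1] and [s <= 0], turning to [th = pi / 2] makes [f dz] purely
    imaginary, so [K] vanishes: this is causality when [a1 >= 0].  In the other
    cases, letting [|x| -> 0] along [t = |x| (a1 + sg)] rescales [s / |x|^(1/g)]
    to any prescribed [u] of the sign of [sg < - a1].  For [g > 1] one takes
    [u -> 0-]: at [u = 0], with [k] the integer nearest to [g / 2], turning to
    [th = pi / 2 - k pi / g] gives a positive multiple of [sin (k pi / g) > 0].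
    For [g < 1] and [a1 < 0] one takes [u] large: turning to [th = - pi / 2]
    gives the Laplace transform at [u] of a function that is positive near 0,
    hence a positive number. *)

Require Import Defs.
From Stdlib Require Import Reals ZArith Lra Lia.
From Coquelicot Require Import Coquelicot.
Open Scope R_scope.

(** * The power |w|^g and the decay of stretched exponentials *)

Lemma exp_le x y : x <= y -> exp x <= exp y.
Proof. intros [H | ->]; [left; now apply exp_increasing | right; reflexivity]. Qed.

Lemma abspow_0 g : abspow 0 g = 0.
Proof.
unfold abspow; rewrite Rabs_R0; destruct (Rlt_dec 0 0); lra.
Qed.

Lemma abspow_pos w g : 0 < w -> abspow w g = Rpower w g.
Proof.
intros Hw; unfold abspow; rewrite Rabs_pos_eq by lra.
destruct (Rlt_dec 0 w); lra.
Qed.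

Lemma abspow_ge0 w g : 0 <= abspow w g.
Proof.
unfold abspow; destruct (Rlt_dec 0 (Rabs w)); [apply Rlt_le, exp_pos | lra].
Qed.

Lemma abspow_opp w g : abspow (- w) g = abspow w g.
Proof. now unfold abspow; rewrite Rabs_Ropp. Qed.

Lemma abspow_le w1 w2 g :
  0 < g -> 0 <= w1 <= w2 -> abspow w1 g <= abspow w2 g.
Proof.
intros Hg [H1 H2].
destruct (Rle_lt_or_eq_dec 0 w1 H1) as [H | <-].
- rewrite !abspow_pos by lra; apply Rle_Rpower_l; lra.
- rewrite abspow_0; apply abspow_ge0.
Qed.

Lemma abspow_mult l w g :
  0 < l -> 0 <= w -> abspow (l * w) g = Rpower l g * abspow w g.
Proof.
intros Hl Hw; destruct (Rle_lt_or_eq_dec 0 w Hw) as [H | <-].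
- rewrite !abspow_pos; auto using Rmult_lt_0_compat.
  now rewrite Rpower_mult_distr.
- now rewrite Rmult_0_r, abspow_0, Rmult_0_r.
Qed.

Lemma abspow_1 g : abspow 1 g = 1.
Proof.
rewrite abspow_pos by lra; unfold Rpower; now rewrite ln_1, Rmult_0_r, exp_0.
Qed.

Lemma continuous_abspow g w : 0 < g -> continuous (fun x => abspow x g) w.
Proof.
intros Hg.
assert (Hpos : forall x, 0 < x -> continuous (fun x => abspow x g) x).
{ intros x Hx.
  apply continuous_ext_loc with (fun x => Rpower x g).
  - exists (mkposreal x Hx); intros y Hy.
    symmetry; apply abspow_pos.
    unfold ball in Hy; simpl in Hy; unfold AbsRing_ball, abs, minus, plus, opp in Hy; simpl in Hy.
    apply Rabs_def2 in Hy; lra.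
  - apply (ex_derive_continuous (fun x => Rpower x g)).
    unfold Rpower; auto_derive; lra. }
destruct (Rtotal_order w 0) as [Hw | [-> | Hw]]; auto.
- apply continuous_ext with (fun x => abspow (- x) g);
    [intros; apply abspow_opp |].
  apply (continuous_comp Ropp (fun x => abspow x g)).
  + apply (continuous_opp (fun x : R => x)), continuous_id.
  + apply Hpos; simpl; lra.
- apply continuity_pt_filterlim, continuity_pt_locally; intros eps.
  (* At 0 the modulus of continuity is explicit: |y| < eps^(1/g) gives |y|^g < eps. *)
  assert (Hd : 0 < Rpower eps (/ g)) by apply exp_pos.
  exists (mkposreal _ Hd); intros y Hy.
  unfold ball in Hy; simpl in Hy; unfold AbsRing_ball, abs, minus, plus, opp in Hy; simpl in Hy.
  rewrite Ropp_0, Rplus_0_r in Hy.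
  rewrite abspow_0, Rminus_0_r, Rabs_pos_eq by apply abspow_ge0.
  unfold abspow; destruct (Rlt_dec 0 (Rabs y)) as [H|_]; [| apply cond_pos].
  replace (pos eps) with (Rpower (Rpower eps (/ g)) g).
  + now apply Rlt_Rpower_l.
  + rewrite Rpower_mult, Rinv_l, Rpower_1; [reflexivity | apply cond_pos | lra].
Qed.

(* A cubic factor is absorbed because [a e^(g x) - 3 x] is bounded below
   (through [e^y >= y^2 / 4]), with [x = ln v]. *)
Lemma stretched_exp_decay a g : 0 < a -> 0 < g ->
  exists C, 0 < C /\
    forall v, 0 <= v -> exp (- a * abspow v g) <= C / (1 + v) ^ 3.
Proof.
intros Ha Hg.
(* 9 / (a g^2) is the maximum over x of 3 x - a (g x)^2 / 4. *)
set (K := exp (9 / (a * g ^ 2))).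
assert (Hden : 0 < a * g ^ 2) by (apply Rmult_lt_0_compat; [lra | now apply pow_lt]).
assert (HK : 1 <= K).
{ unfold K; rewrite <- exp_0.
  apply exp_le, Rlt_le, Rdiv_lt_0_compat; lra. }
(* The 8 is 2^3, from 1 + v <= 2 max(1, v). *)
exists (8 * K); split; [lra |].
intros v Hv.
assert (Hp : 0 < (1 + v) ^ 3) by (apply pow_lt; lra).
apply (Rmult_le_reg_r _ _ _ Hp); unfold Rdiv.
rewrite Rmult_assoc, Rinv_l, Rmult_1_r by lra.
destruct (Rle_lt_dec v 1) as [H1 | H1].
- assert (exp (- a * abspow v g) <= 1).
  { rewrite <- exp_0; pose proof (abspow_ge0 v g).
    apply exp_le; nra. }
  assert ((1 + v) ^ 3 <= 8) by (replace 8 with (2 ^ 3) by lra; apply pow_incr; lra).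
  pose proof (exp_pos (- a * abspow v g)); nra.
- set (x := ln v).
  assert (Hx : 0 < x) by (unfold x; rewrite <- ln_1; apply ln_increasing; lra).
  assert (Ev : v = exp x) by (unfold x; rewrite exp_ln; lra).
  assert (Hc : (1 + v) ^ 3 <= 8 * v ^ 3).
  { replace (8 * v ^ 3) with ((2 * v) ^ 3) by ring; apply pow_incr; lra. }
  assert (E3 : v ^ 3 = exp (3 * x)).
  { rewrite Ev; replace (3 * x) with (x + x + x) by ring.
    rewrite !exp_plus; ring. }
  assert (Hsq : (g * x) ^ 2 / 4 <= abspow v g).
  { rewrite abspow_pos by lra; unfold Rpower; fold x.
    assert (Hh := exp_ineq1_le (g * x / 2)).
    replace (exp (g * x)) with (exp (g * x / 2 + g * x / 2)) by (f_equal; field).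
    rewrite exp_plus.
    assert (0 < g * x / 2) by nra. nra. }
  assert (Hexp : 3 * x - a * abspow v g <= 9 / (a * g ^ 2)).
  { assert (3 * x - a * ((g * x) ^ 2 / 4) <= 9 / (a * g ^ 2)).
    { apply (Rmult_le_reg_r _ _ _ Hden).
      unfold Rdiv at 2; rewrite Rmult_assoc, Rinv_l by lra.
      pose proof (pow2_ge_0 (3 - a * g ^ 2 * x / 2)). nra. }
    nra. }
  assert (exp (3 * x) * exp (- a * abspow v g) <= K).
  { rewrite <- exp_plus; apply exp_le; lra. }
  pose proof (exp_pos (- a * abspow v g)).
  rewrite E3 in Hc. nra.
Qed.

(** * Structural continuity tactics; the side condition [0 < g] of [abspow] is left over *)

Ltac cont :=
  repeat match goal with
  | |- continuous (fun x => x) _ => apply continuous_id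
  | |- continuous (fun _ => ?c) _ => apply continuous_const
  | |- continuous (fun x => abspow x _) _ => apply continuous_abspow
  | |- continuous (fun x => @?f x + @?g x) _ => apply (continuous_plus f g)
  | |- continuous (fun x => @?f x - @?g x) _ => apply (continuous_minus f g)
  | |- continuous (fun x => @?f x * @?g x) _ => apply (continuous_mult f g)
  | |- continuous (fun x => - @?f x) _ => apply (continuous_opp f)
  | |- continuous (fun x => exp (@?f x)) _ => apply (continuous_exp_comp f)
  | |- continuous (fun x => cos (@?f x)) _ => apply (continuous_cos_comp f)
  | |- continuous (fun x => sin (@?f x)) _ => apply (continuous_sin_comp f)
  end.

Ltac cont2 :=
  repeat match goal with
  | |- continuity_2d_pt (fun _ _ => ?c) _ _ => apply continuity_2d_pt_const
  | |- continuity_2d_pt (fun u _ => u) _ _ => apply continuity_2d_pt_id1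
  | |- continuity_2d_pt (fun _ v => v) _ _ => apply continuity_2d_pt_id2
  | |- continuity_2d_pt (fun u v => @?f u v + @?g u v) _ _ => apply (continuity_2d_pt_plus f g)
  | |- continuity_2d_pt (fun u v => @?f u v - @?g u v) _ _ => apply (continuity_2d_pt_minus f g)
  | |- continuity_2d_pt (fun u v => @?f u v * @?g u v) _ _ => apply (continuity_2d_pt_mult f g)
  | |- continuity_2d_pt (fun u v => - @?f u v) _ _ => apply (continuity_2d_pt_opp f)
  | |- continuity_2d_pt (fun u v => exp (@?f u v)) _ _ => apply (continuity_1d_2d_pt_comp exp f)
  | |- continuity_2d_pt (fun u v => cos (@?f u v)) _ _ => apply (continuity_1d_2d_pt_comp cos f)
  | |- continuity_2d_pt (fun u v => sin (@?f u v)) _ _ => apply (continuity_1d_2d_pt_comp sin f)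
  | |- continuity_2d_pt (fun u v => abspow v ?g) _ _ => apply (continuity_1d_2d_pt_comp (fun x => abspow x g) (fun u v => v))
  | |- continuity_pt exp _ => apply derivable_continuous_pt, derivable_pt_exp
  | |- continuity_pt cos _ => apply continuity_cos
  | |- continuity_pt sin _ => apply continuity_sin
  | |- continuity_pt (fun x => abspow x _) _ => apply continuity_pt_filterlim, continuous_abspow
  end.

(** * Integrals along rays from the origin, and rotation of the ray *)

Lemma ex_RInt_cont (f : R -> R) a b : (forall x, continuous f x) -> ex_RInt f a b.
Proof. intros H; apply (ex_RInt_continuous (V := R_CompleteNormedModule)); auto. Qed.

(* Along the ray [z = w e^(i th)], the holomorphic form
   [exp (- c (-i z)^g - i z s) dz] equals
   [exp (ray_mod + i ray_arg) dw]. *)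
Definition ray_mod (c g s th w : R) : R :=
  - c * abspow w g * cos (g * (th - PI / 2)) + s * w * sin th.

Definition ray_arg (c g s th w : R) : R :=
  - c * abspow w g * sin (g * (th - PI / 2)) - s * w * cos th + th.

Definition ray (c g s th w : R) : R :=
  exp (ray_mod c g s th w) * cos (ray_arg c g s th w).

Definition ray_im (c g s th w : R) : R :=
  exp (ray_mod c g s th w) * sin (ray_arg c g s th w).

Lemma continuous_ray c g s th w : 0 < g -> continuous (ray c g s th) w.
Proof. intros Hg; unfold ray, ray_mod, ray_arg; cont; exact Hg. Qed.

Lemma continuous_ray_im c g s th w : 0 < g -> continuous (ray_im c g s th) w.
Proof. intros Hg; unfold ray_im, ray_mod, ray_arg; cont; exact Hg. Qed.

(** Angular derivative of [ray] in closed form, to be matched with a radial derivative and seen to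
    be jointly continuous. The summand 1 comes from the factor e^(i th) of dz. *)
Definition ray_dth (c g s th w : R) : R :=
  exp (ray_mod c g s th w) *
  (cos (ray_arg c g s th w) *
     (c * g * abspow w g * sin (g * (th - PI / 2)) + s * w * cos th) -
   sin (ray_arg c g s th w) *
     (- c * g * abspow w g * cos (g * (th - PI / 2)) + s * w * sin th + 1)).

Lemma is_derive_ray_th c g s th w :
  is_derive (fun th => ray c g s th w) th (ray_dth c g s th w).
Proof.
unfold ray, ray_dth, ray_mod, ray_arg; generalize (abspow w g); intros p.
auto_derive; [exact I |]. unfold Rminus; ring.
Qed.

(* Cauchy-Riemann: the angular derivative of [f dz] is exact along the ray. *)
Lemma is_derive_ray_w c g s th w : 0 < g -> 0 <= w ->
  is_derive (fun w => - (w * ray_im c g s th w)) w (ray_dth c g s th w).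
Proof.
intros Hg [Hw | <-].
- apply is_derive_ext_loc with
    (fun w => - (w * (exp (- c * exp (g * ln w) * cos (g * (th - PI / 2)) + s * w * sin th) *
       sin (- c * exp (g * ln w) * sin (g * (th - PI / 2)) - s * w * cos th + th)))).
  + exists (mkposreal w Hw); intros y Hy.
    unfold ball in Hy; simpl in Hy; unfold AbsRing_ball, abs, minus, plus, opp in Hy; simpl in Hy.
    apply Rabs_def2 in Hy.
    unfold ray_im, ray_mod, ray_arg; rewrite abspow_pos by lra; reflexivity.
  + unfold ray_dth, ray_mod, ray_arg; rewrite abspow_pos by lra.
    auto_derive; [lra |]. unfold Rpower, Rminus. field; lra.
(* At w = 0 the power is not differentiable when g < 1, but the difference quotient of [w * ray_im]
   is [ray_im] itself, so continuity suffices. *)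
- apply is_derive_Reals; intros eps Heps.
  assert (Hc := continuous_ray_im c g s th 0 Hg).
  apply continuity_pt_filterlim in Hc; rewrite continuity_pt_locally in Hc.
  destruct (Hc (mkposreal eps Heps)) as [d Hd].
  exists d; intros h Hh Hhd.
  assert (E0 : ray_dth c g s th 0 = - ray_im c g s th 0).
  { unfold ray_dth, ray_im; rewrite abspow_0; ring. }
  rewrite E0.
  replace ((- ((0 + h) * ray_im c g s th (0 + h)) - - (0 * ray_im c g s th 0)) / h
     - - ray_im c g s th 0) with (- (ray_im c g s th h - ray_im c g s th 0)).
  + rewrite Rabs_Ropp; apply (Hd h).
    unfold ball; simpl; unfold AbsRing_ball, abs, minus, plus, opp; simpl.
    now rewrite Ropp_0, Rplus_0_r.
  + rewrite Rplus_0_l; field; exact Hh.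
Qed.

(** Since the angular derivative of [ray] is the radial derivative of [- (w * ray_im)],
    differentiating under the integral leaves only the endpoint term at M, the contribution of the
    arc; the mean value theorem bounds the change by the angle swept times M K. *)
Lemma ray_rotation c g s th1 th2 M K : 0 < g -> 0 <= M ->
  (forall th, Rmin th1 th2 <= th <= Rmax th1 th2 ->
     exp (ray_mod c g s th M) <= K) ->
  Rabs (RInt (ray c g s th2) 0 M - RInt (ray c g s th1) 0 M)
    <= Rabs (th2 - th1) * (M * K).
Proof.
intros Hg HM HK.
assert (Hd : forall th, is_derive (fun th => RInt (ray c g s th) 0 M) th
               (- (M * ray_im c g s th M))).
{ intros th.
  assert (HD : RInt (fun w => Derive (fun th => ray c g s th w) th) 0 M
             = - (M * ray_im c g s th M)).
  { rewrite (RInt_ext _ (ray_dth c g s th)).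
    2: intros x _; apply is_derive_unique, is_derive_ray_th.
    replace (- (M * ray_im c g s th M)) with
      (minus (- (M * ray_im c g s th M)) (- (0 * ray_im c g s th 0)))
      by (unfold minus, plus, opp; simpl; ring).
    apply is_RInt_unique, (is_RInt_derive (fun w => - (w * ray_im c g s th w))).
    - intros x; rewrite Rmin_left, Rmax_right by lra; intros Hx.
      apply is_derive_ray_w; lra.
    - intros x _; unfold ray_dth, ray_mod, ray_arg; cont; exact Hg. }
  rewrite <- HD.
  apply (is_derive_RInt_param (fun th w => ray c g s th w)).
  - apply filter_forall; intros x t _; eexists; apply is_derive_ray_th.
  - intros t _.
    apply continuity_2d_pt_ext with (ray_dth c g s).
    + intros; symmetry; apply is_derive_unique, is_derive_ray_th.
    + unfold ray_dth, ray_mod, ray_arg; cont2; exact Hg.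
  - apply filter_forall; intros x; apply ex_RInt_cont; intros; now apply continuous_ray. }
destruct (MVT_gen (fun th => RInt (ray c g s th) 0 M) th1 th2
            (fun th => - (M * ray_im c g s th M))) as [xi [Hxi E]].
- intros x _; apply Hd.
- intros x _; apply derivable_continuous_pt, ex_derive_Reals_0; eexists; apply Hd.
- simpl in E; rewrite E, Rabs_mult, Rmult_comm.
  apply Rmult_le_compat_l; [apply Rabs_pos |].
  rewrite Rabs_Ropp, Rabs_mult, (Rabs_pos_eq M) by exact HM.
  apply Rmult_le_compat_l; [exact HM |].
  unfold ray_im; rewrite Rabs_mult, Rabs_pos_eq by apply Rlt_le, exp_pos.
  specialize (HK xi Hxi).
  assert (Rabs (sin (ray_arg c g s xi M)) <= 1) by (apply Rabs_le, SIN_bound).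
  pose proof (exp_pos (ray_mod c g s xi M)); pose proof (Rabs_pos (sin (ray_arg c g s xi M))).
  nra.
Qed.

(** * Symmetry of the integrand and reduction of K to the half-line *)

Lemma RInt_even (f : R -> R) M :
  (forall x, continuous f x) -> (forall x, f (- x) = f x) ->
  RInt f (- M) 0 = RInt f 0 M.
Proof.
intros Hc He.
assert (H := RInt_correct f 0 M (ex_RInt_cont f 0 M Hc)).
assert (H' : is_RInt f (- 0) (- - M) (RInt f 0 M)) by now rewrite Ropp_0, Ropp_involutive.
apply is_RInt_comp_opp in H'.
apply is_RInt_swap in H'.
apply (is_RInt_unique (V := R_CompleteNormedModule)) in H'.
rewrite (RInt_ext _ (fun y => opp (f y))) in H'.
2: intros; now rewrite He.
rewrite (RInt_opp f) in H' by now apply ex_RInt_cont.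
unfold opp in H'; simpl in H'; lra.
Qed.

Lemma RInt_odd (f : R -> R) M :
  (forall x, continuous f x) -> (forall x, f (- x) = - f x) ->
  RInt f (- M) 0 = - RInt f 0 M.
Proof.
intros Hc He.
assert (H := RInt_correct f 0 M (ex_RInt_cont f 0 M Hc)).
assert (H' : is_RInt f (- 0) (- - M) (RInt f 0 M)) by now rewrite Ropp_0, Ropp_involutive.
apply is_RInt_comp_opp in H'.
apply is_RInt_swap in H'.
apply (is_RInt_unique (V := R_CompleteNormedModule)) in H'.
rewrite (RInt_ext _ f) in H'; [exact H' |].
intros; rewrite He; unfold opp; simpl; ring.
Qed.

Section Kernel.
Variables (a0 a1 g : R) (x : R * R * R) (t : R).
Hypothesis Hg : 0 < g.
Let r := norm3 x.
Let c := a0 / cos (PI * g / 2).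
Let s := t - r * a1.

Lemma angle_0 : cos (g * (0 - PI / 2)) = cos (PI * g / 2) /\
  sin (g * (0 - PI / 2)) = - sin (PI * g / 2).
Proof.
replace (g * (0 - PI / 2)) with (- (PI * g / 2)) by field.
now rewrite cos_neg, sin_neg.
Qed.

Lemma K_integrand_pos w : 0 <= w -> K_integrand a0 a1 g x t w =
  (/ (2 * PI) * ray (r * c) g s 0 w, / (2 * PI) * ray_im (r * c) g s 0 w).
Proof.
intros Hw; destruct angle_0 as [Ec Es].
unfold K_integrand, cexp, alpha_pl, mi_pow, ray, ray_im, ray_mod, ray_arg, Cmult, Cplus, RtoC.
fold r; fold c; simpl.
rewrite Ec, Es, cos_0, sin_0.
assert (HS : sgnR w * abspow w g = abspow w g).
{ unfold sgnR; destruct (Rlt_dec 0 w) as [|n]; [ring |].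
  replace w with 0 by lra; rewrite abspow_0; ring. }
set (p := abspow w g) in *; set (C := cos _); set (S := sin _).
match goal with |- (?k * (exp ?E * cos ?T) - _, _) = (_ * (exp ?E' * cos ?T'), _) =>
  replace E with E' by (unfold s; ring); replace T with T' end.
2: { unfold s.
     replace (- sgnR w * p * S) with (- (sgnR w * p) * S) by ring; rewrite HS; ring. }
f_equal; ring.
Qed.

Lemma K_integrand_opp w : K_integrand a0 a1 g x t (- w) =
  (fst (K_integrand a0 a1 g x t w), - snd (K_integrand a0 a1 g x t w)).
Proof.
unfold K_integrand, cexp, alpha_pl, mi_pow, Cmult, Cplus, RtoC; simpl.
rewrite abspow_opp.
assert (HS : sgnR (- w) = - sgnR w).
{ unfold sgnR; repeat destruct Rlt_dec; lra. }
rewrite HS.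
match goal with |- (_ * (exp ?E * cos ?T) - _, _) = (_ * (exp ?E' * cos ?T') - _, _) =>
  replace E with E' by ring; replace T with (- T') by ring end.
rewrite cos_neg, sin_neg; f_equal; ring.
Qed.

(** Passing to |w| hides the jump of [sgnR] at 0, so continuity on the whole line follows by
    composition. *)
Lemma K_integrand_fst w :
  fst (K_integrand a0 a1 g x t w) = / (2 * PI) * ray (r * c) g s 0 (Rabs w).
Proof.
destruct (Rle_lt_dec 0 w) as [H | H].
- now rewrite Rabs_pos_eq, K_integrand_pos.
- rewrite Rabs_left by exact H.
  replace w with (- - w) at 1 by ring.
  rewrite K_integrand_opp, K_integrand_pos by lra; reflexivity.
Qed.

Lemma continuous_K_fst w : continuous (fun w => fst (K_integrand a0 a1 g x t w)) w.
Proof.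
apply continuous_ext with (fun w => / (2 * PI) * ray (r * c) g s 0 (Rabs w)).
- intros; symmetry; apply K_integrand_fst.
- apply (continuous_mult (fun _ => / (2 * PI))); [apply continuous_const |].
  apply (continuous_comp Rabs (ray (r * c) g s 0)).
  + apply continuous_Rabs.
  + now apply continuous_ray.
Qed.

(** At angle 0 [ray_im] vanishes at the origin, so its odd extension is a difference of two
    truncations by [Rmax], visibly continuous across 0. *)
Lemma K_integrand_snd w :
  snd (K_integrand a0 a1 g x t w) =
  / (2 * PI) * (ray_im (r * c) g s 0 (Rmax 0 w) - ray_im (r * c) g s 0 (Rmax 0 (- w))).
Proof.
assert (H0 : ray_im (r * c) g s 0 0 = 0).
{ unfold ray_im, ray_arg; rewrite abspow_0.
  replace (- (r * c) * 0 * sin (g * (0 - PI / 2)) - s * 0 * cos 0 + 0) with 0 by ring.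
  rewrite sin_0; ring. }
destruct (Rle_lt_dec 0 w) as [H | H].
- rewrite Rmax_right, (Rmax_left 0 (- w)), K_integrand_pos, H0 by lra; simpl; ring.
- rewrite Rmax_left, (Rmax_right 0 (- w)), H0 by lra.
  replace w with (- - w) at 1 by ring.
  rewrite K_integrand_opp, K_integrand_pos by lra; simpl; ring.
Qed.

Lemma continuous_K_snd w : continuous (fun w => snd (K_integrand a0 a1 g x t w)) w.
Proof.
apply continuous_ext with (fun w =>
  / (2 * PI) * (ray_im (r * c) g s 0 (Rmax 0 w) - ray_im (r * c) g s 0 (Rmax 0 (- w)))).
- intros; symmetry; apply K_integrand_snd.
- assert (Hm : forall y, continuous (Rmax 0) y).
  { intros y; apply continuous_ext with (fun y => / 2 * (y + Rabs y)).
    - intros z; unfold Rabs, Rmax; destruct Rcase_abs, Rle_dec; lra.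
    - apply (continuous_mult (fun _ => / 2)); [apply continuous_const |].
      apply (continuous_plus (fun y : R => y) Rabs); [apply continuous_id | apply continuous_Rabs]. }
  apply (continuous_mult (fun _ => / (2 * PI))); [apply continuous_const |].
  apply (continuous_minus (fun w => ray_im (r * c) g s 0 (Rmax 0 w))
           (fun w => ray_im (r * c) g s 0 (Rmax 0 (- w)))).
  + apply (continuous_comp (Rmax 0) (ray_im (r * c) g s 0)); [apply Hm |].
    now apply continuous_ray_im.
  + apply (continuous_comp (fun w => Rmax 0 (- w)) (ray_im (r * c) g s 0)).
    * apply (continuous_comp Ropp (Rmax 0)); [| apply Hm].
      apply (continuous_opp (fun w : R => w)), continuous_id.
    * now apply continuous_ray_im.
Qed.

Lemma RInt_K_fst_pos M : 0 <= M ->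
  RInt (fun w => fst (K_integrand a0 a1 g x t w)) 0 M =
  / (2 * PI) * RInt (ray (r * c) g s 0) 0 M.
Proof.
intros HM.
rewrite (RInt_ext _ (fun w => scal (/ (2 * PI)) (ray (r * c) g s 0 w))).
- apply (RInt_scal (ray (r * c) g s 0)), ex_RInt_cont; intros; now apply continuous_ray.
- intros w; rewrite Rmin_left, Rmax_right by exact HM; intros Hw.
  rewrite K_integrand_pos by lra; reflexivity.
Qed.

Lemma RInt_K_snd_pos M : 0 <= M ->
  RInt (fun w => snd (K_integrand a0 a1 g x t w)) 0 M =
  / (2 * PI) * RInt (ray_im (r * c) g s 0) 0 M.
Proof.
intros HM.
rewrite (RInt_ext _ (fun w => scal (/ (2 * PI)) (ray_im (r * c) g s 0 w))).
- apply (RInt_scal (ray_im (r * c) g s 0)), ex_RInt_cont; intros; now apply continuous_ray_im.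
- intros w; rewrite Rmin_left, Rmax_right by exact HM; intros Hw.
  rewrite K_integrand_pos by lra; reflexivity.
Qed.

(** The double limit may be taken along symmetric intervals [-M, M]; there the even real part counts
    twice, which turns 1/(2 PI) into 1/PI. *)
Lemma K_is_0_limit : K_is a0 a1 g x t 0 ->
  forall eps, 0 < eps -> exists N, forall M, N < M ->
    Rabs (RInt (ray (r * c) g s 0) 0 M) < eps.
Proof.
intros HK eps Heps.
assert (HP : 0 < 2 * PI) by (pose proof PI_RGT_0; lra).
assert (Hd : 0 < eps / PI) by (pose proof PI_RGT_0; apply Rdiv_lt_0_compat; lra).
assert (Hloc : locally (0 : C) (fun z => Rabs (fst z) < eps / PI)).
{ exists (mkposreal _ Hd); intros z [Hz _].
  unfold ball in Hz; simpl in Hz; unfold AbsRing_ball, abs, minus, plus, opp in Hz; simpl in Hz.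
  now rewrite Ropp_0, Rplus_0_r in Hz. }
destruct (HK _ Hloc) as [Q1 Q2 [N1 HQ1] [N2 HQ2] H].
exists (Rmax 0 (Rmax (- N1) N2)); intros M HM.
assert (M > 0) by (eapply Rle_lt_trans; [apply Rmax_l | exact HM]).
assert (Rmax (- N1) N2 < M) by (eapply Rle_lt_trans; [apply Rmax_r | exact HM]).
assert (- N1 < M) by (eapply Rle_lt_trans; [apply Rmax_l | eassumption]).
assert (N2 < M) by (eapply Rle_lt_trans; [apply Rmax_r | eassumption]).
destruct (H (- M) M) as [y [Hy Hy']]; [apply HQ1; lra | apply HQ2; lra |].
simpl in Hy; apply is_RInt_fct_extend_fst, (is_RInt_unique (V := R_CompleteNormedModule)) in Hy.
rewrite <- (RInt_Chasles _ (- M) 0 M) in Hy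
  by (apply ex_RInt_cont, continuous_K_fst).
rewrite RInt_even in Hy.
- rewrite RInt_K_fst_pos in Hy by lra.
  unfold plus in Hy; simpl in Hy.
  replace (RInt (ray (r * c) g s 0) 0 M) with (PI * fst y).
  2: { match type of Hy with ?L = _ => replace (fst y) with L by exact Hy end.
     field; pose proof PI_RGT_0; lra. }
  pose proof PI_RGT_0.
  rewrite Rabs_mult, (Rabs_pos_eq PI) by lra.
  apply Rmult_lt_compat_l with (r := PI) in Hy'; [| lra].
  replace (PI * (eps / PI)) with eps in Hy' by (field; lra); exact Hy'.
- apply continuous_K_fst.
- intros w; now rewrite K_integrand_opp.
Qed.

End Kernel.

(** * Causality after rescaling *)

(* With [|x| = l^(-g)], the substitution [w = l v] removes |x| from the
   exponent [-c |x| (-i w)^g] and turns [|x| sg] into [l^(1-g) sg]. *)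
Lemma causal_limit a0 a1 g : 0 < g -> K_causal a0 a1 g ->
  forall l sg, 0 < l -> sg < - a1 ->
  forall eps, 0 < eps -> exists N, forall M, N < M ->
    Rabs (RInt (ray (a0 / cos (PI * g / 2)) g (Rpower l (1 - g) * sg) 0) 0 M) < eps.
Proof.
intros Hg HK l sg Hl Hsg eps Heps.
set (r := Rpower l (- g)).
assert (Hr : 0 < r) by apply exp_pos.
assert (Hn : norm3 (r, 0, 0) = r).
{ unfold norm3; replace (r ^ 2 + 0 ^ 2 + 0 ^ 2) with (r * r) by ring.
  apply sqrt_square; lra. }
assert (Hx : (r, 0, 0) <> (0, 0, 0)) by (intros E; injection E; lra).
(* The time is chosen so that t - r a1 = r sg; then sg < - a1 is exactly t < 0. *)
assert (Ht : r * (sg + a1) < 0) by nra.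
destruct (K_is_0_limit a0 a1 g (r, 0, 0) (r * (sg + a1)) Hg (HK _ _ Hx Ht) (l * eps))
  as [N HN]; [now apply Rmult_lt_0_compat |].
exists (Rmax 0 (N / l)); intros M HM.
assert (HM0 : 0 < M) by (eapply Rle_lt_trans; [apply Rmax_l | exact HM]).
assert (HMN : N / l < M) by (eapply Rle_lt_trans; [apply Rmax_r | exact HM]).
assert (HlM : N < l * M).
{ apply Rmult_lt_compat_l with (r := l) in HMN; [| lra].
  now replace (l * (N / l)) with N in HMN by (field; lra). }
specialize (HN _ HlM).
rewrite Hn in HN.
replace (r * (sg + a1) - r * a1) with (r * sg) in HN by ring.
set (c := a0 / cos (PI * g / 2)) in *.
assert (E : RInt (ray (r * c) g (r * sg) 0) 0 (l * M)
          = l * RInt (ray c g (Rpower l (1 - g) * sg) 0) 0 M).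
{ replace (RInt (ray (r * c) g (r * sg) 0) 0 (l * M)) with
    (RInt (ray (r * c) g (r * sg) 0) (l * 0 + 0) (l * M + 0)) by (f_equal; ring).
  rewrite <- (RInt_comp_lin (ray (r * c) g (r * sg) 0)).
  - rewrite (RInt_ext _ (fun v => scal l (ray c g (Rpower l (1 - g) * sg) 0 v))).
    + apply (RInt_scal (ray c g (Rpower l (1 - g) * sg) 0)), ex_RInt_cont; intros;
      now apply continuous_ray.
    + intros v; rewrite Rmin_left, Rmax_right by lra; intros Hv.
      f_equal; rewrite Rplus_0_r.
      assert (E1 : r * Rpower l g = 1).
      { unfold r; rewrite <- Rpower_plus, Rplus_opp_l; apply Rpower_O, Hl. }
      assert (E2 : Rpower l (1 - g) = l * r).
      { unfold r; rewrite <- (Rpower_1 l) at 2 by exact Hl.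
        now rewrite <- Rpower_plus. }
      assert (Ep : r * abspow (l * v) g = abspow v g).
      { rewrite abspow_mult by lra.
        now rewrite <- Rmult_assoc, E1, Rmult_1_l. }
      unfold ray, ray_mod, ray_arg; rewrite <- Ep, E2.
      f_equal; f_equal; ring.
  - apply ex_RInt_cont; intros; now apply continuous_ray. }
rewrite E, Rabs_mult, Rabs_pos_eq in HN by lra.
now apply Rmult_lt_reg_l in HN.
Qed.

(** * Tail bounds, and causality for 0 < g < 1 and a1 >= 0 *)

Lemma RInt_decay (f : R -> R) C a b : 0 < C -> 0 <= a <= b ->
  (forall v, continuous f v) ->
  (forall v, 0 <= v -> Rabs (f v) <= C / (1 + v) ^ 2) ->
  Rabs (RInt f a b) <= C / (1 + a).
Proof.
intros HC Hab Hf Hb.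
assert (Hprim : is_RInt (fun v => C / (1 + v) ^ 2) a b
          (minus (- (C / (1 + b))) (- (C / (1 + a))))).
{ apply (is_RInt_derive (fun v => - (C / (1 + v)))).
  - intros v; rewrite Rmin_left, Rmax_right by lra; intros Hv.
    auto_derive; [lra | field; lra].
  - intros v; rewrite Rmin_left, Rmax_right by lra; intros Hv.
    apply (ex_derive_continuous (fun v => C / (1 + v) ^ 2)).
    auto_derive.
    assert (0 < 1 + v) by lra; nra. }
apply Rle_trans with (RInt (fun v => Rabs (f v)) a b);
  [apply abs_RInt_le; [lra | now apply ex_RInt_cont] |].
apply Rle_trans with (RInt (fun v => C / (1 + v) ^ 2) a b).
- apply RInt_le; [lra | | eexists; exact Hprim | intros; apply Hb; lra].
  apply ex_RInt_cont; intros v; now apply continuous_Rabs_comp.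
- rewrite (is_RInt_unique (V := R_CompleteNormedModule) _ _ _ _ Hprim).
  unfold minus, plus, opp; simpl.
  assert (0 < C / (1 + b)) by (apply Rdiv_lt_0_compat; lra). lra.
Qed.

(** Rotation costs a factor M and the Lipschitz bound in u a factor v; cubic decay absorbs either
    and still leaves a vanishing or integrable bound. *)
Lemma weight_decay C v : 0 < C -> 0 <= v ->
  C / (1 + v) ^ 3 <= C / (1 + v) ^ 2 /\ v * (C / (1 + v) ^ 3) <= C / (1 + v) ^ 2 /\
  v * (C / (1 + v) ^ 3) <= C / (1 + v).
Proof.
intros HC Hv.
set (y := / (1 + v)).
assert (Hy : 0 < y) by (apply Rinv_0_lt_compat; lra).
assert (Hvy : v * y = 1 - y) by (unfold y; field; lra).
assert (E : forall n, C / (1 + v) ^ n = C * y ^ n)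
  by (intros; unfold y, Rdiv; now rewrite pow_inv).
rewrite !E; replace (C / (1 + v)) with (C * y) by reflexivity.
replace (v * (C * y ^ 3)) with (C * y ^ 2 * (v * y)) by ring; rewrite Hvy.
assert (0 <= v * y) by nra.
assert (0 < C * y) by nra.
assert (0 < C * y ^ 2) by nra.
repeat split; try nra.
Qed.

(** The condition is on the product because for g > 1 both [c] and the cosine may be negative; their
    product governs the modulus on the real axis. *)
Lemma ray_0_decay b g s c :
  0 < b -> 0 < g -> c * cos (PI * g / 2) = b ->
  exists C, 0 < C /\ forall v, 0 <= v ->
    exp (ray_mod c g s 0 v) <= C / (1 + v) ^ 3.
Proof.
intros Hb Hg E.
destruct (stretched_exp_decay b g Hb Hg) as [C [HC H]].
exists C; split; [exact HC |]; intros v Hv.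
unfold ray_mod; destruct (angle_0 g) as [-> _].
rewrite sin_0, <- E in *.
replace (- c * abspow v g * cos (PI * g / 2) + s * v * 0)
  with (- (c * cos (PI * g / 2)) * abspow v g) by ring.
now apply H.
Qed.

Lemma cos_half_pos g : 0 < g < 1 -> 0 < cos (PI * g / 2).
Proof. intros Hg; pose proof PI_RGT_0; apply cos_gt_0; nra. Qed.

(* For [s <= 0] the ray may be turned onto the positive imaginary axis, where
   [f dz] is purely imaginary. *)
Lemma ray_re_vanishes b g s c :
  0 < b -> 0 < g < 1 -> c * cos (PI * g / 2) = b -> s <= 0 ->
  exists C, 0 < C /\ forall M, 0 <= M ->
    Rabs (RInt (ray c g s 0) 0 M) <= C / (1 + M).
Proof.
intros Hb Hg E Hs.
pose proof (cos_half_pos g Hg) as Hcos; pose proof PI_RGT_0 as HPI.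
destruct (stretched_exp_decay b g Hb (proj1 Hg)) as [C [HC H]].
exists (PI / 2 * C); split; [nra |]; intros M HM.
assert (H0 : RInt (ray c g s (PI / 2)) 0 M = 0).
{ rewrite (RInt_ext _ (fun _ => 0)).
  - rewrite RInt_const; apply (scal_zero_r (V := R_CompleteNormedModule)).
  - intros w _; unfold ray, ray_arg.
    replace (g * (PI / 2 - PI / 2)) with 0 by ring; rewrite sin_0, cos_PI2.
    replace (- c * abspow w g * 0 - s * w * 0 + PI / 2) with (PI / 2) by ring.
    rewrite cos_PI2; apply Rmult_0_r. }
assert (Hrot := ray_rotation c g s 0 (PI / 2) M (C / (1 + M) ^ 3) (proj1 Hg) HM).
rewrite H0, Rminus_0_l, Rabs_Ropp, Rminus_0_r, (Rabs_pos_eq (PI / 2)) in Hrot by lra.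
eapply Rle_trans; [apply Hrot |].
- intros th; rewrite Rmin_left, Rmax_right by lra; intros Hth.
  eapply Rle_trans; [| apply (H M HM)].
  unfold ray_mod.
  (* The angle runs through [- PI g / 2, 0], where the cosine is smallest at the left end; the term
     in s <= 0 only lowers the modulus. *)
  assert (Hc : cos (PI * g / 2) <= cos (g * (th - PI / 2))).
  { rewrite <- (cos_neg (g * (th - PI / 2))).
    apply cos_decr_1; nra. }
  assert (Hsin : 0 <= sin th) by (apply sin_ge_0; lra).
  pose proof (abspow_ge0 M g) as Hp.
  assert (Hc0 : 0 < c) by nra.
  assert (Hle : - c * abspow M g * cos (g * (th - PI / 2)) + s * M * sin th
            <= - b * abspow M g).
  { rewrite <- E.
    assert (0 <= c * abspow M g) by nra.
    assert (s * M <= 0) by nra. nra. }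
  now apply exp_le.
- destruct (weight_decay C M HC HM) as [_ [_ Hw]].
  replace (PI / 2 * C / (1 + M)) with (PI / 2 * (C / (1 + M))) by (field; lra).
  apply Rmult_le_compat_l; lra.
Qed.

(** The two ends of integration tend to infinity independently. The real part is small on each
    half-line separately; the imaginary parts cancel by oddness up to the piece between - a and b,
    which is a tail. *)
Lemma causal_of_nonneg a0 a1 g : 0 < a0 -> 0 < g < 1 -> 0 <= a1 -> K_causal a0 a1 g.
Proof.
intros Ha Hg Ha1 x t Hx Ht.
pose proof (cos_half_pos g Hg) as Hcos; pose proof PI_RGT_0 as HPI.
assert (Hr : 0 < norm3 x).
{ destruct x as [[x1 x2] x3]; unfold norm3; apply sqrt_lt_R0.
  destruct (Req_dec x1 0) as [-> |]; [destruct (Req_dec x2 0) as [-> |];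
    [destruct (Req_dec x3 0) as [-> |]; [easy |] |] |]; nra. }
set (r := norm3 x) in *; set (c := a0 / cos (PI * g / 2)); set (s := t - r * a1).
assert (E : r * c * cos (PI * g / 2) = r * a0) by (unfold c; field; lra).
assert (Hb : 0 < r * a0) by nra.
assert (Hs : s <= 0) by (unfold s; nra).
destruct (ray_re_vanishes _ g s (r * c) Hb Hg E Hs) as [C1 [HC1 H1]].
destruct (ray_0_decay _ g s (r * c) Hb (proj1 Hg) E) as [C2 [HC2 H2]].
assert (Him : forall a b, 0 <= a -> 0 <= b ->
   Rabs (RInt (ray_im (r * c) g s 0) 0 b - RInt (ray_im (r * c) g s 0) 0 a)
     <= C2 / (1 + Rmin a b)).
{ assert (Him' : forall a b, 0 <= a <= b ->
   Rabs (RInt (ray_im (r * c) g s 0) 0 b - RInt (ray_im (r * c) g s 0) 0 a)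
     <= C2 / (1 + a)).
  { intros a b Hab.
    rewrite <- (RInt_Chasles _ 0 a b) by (apply ex_RInt_cont; intros; now apply continuous_ray_im).
    unfold plus; simpl; rewrite Rplus_minus_l.
    apply RInt_decay; [lra | lra | intros; now apply continuous_ray_im |].
    intros v Hv; unfold ray_im; rewrite Rabs_mult, Rabs_pos_eq by apply Rlt_le, exp_pos.
    assert (Rabs (sin (ray_arg (r * c) g s 0 v)) <= 1) by (apply Rabs_le, SIN_bound).
    pose proof (exp_pos (ray_mod (r * c) g s 0 v)).
    specialize (H2 v Hv); destruct (weight_decay C2 v HC2 Hv) as [Hw _].
    pose proof (Rabs_pos (sin (ray_arg (r * c) g s 0 v))). nra. }
  intros a b Ha' Hb'; unfold Rmin; destruct (Rle_dec a b).
  - apply Him'; lra.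
  - rewrite Rabs_minus_sym; apply Him'; lra. }
intros P [eps HP].
set (N := (C1 + C2) / eps).
assert (Heps := cond_pos eps).
assert (HN : 0 < N) by (apply Rdiv_lt_0_compat; lra).
assert (Hfar : forall y C, N < y -> 0 < C <= C1 + C2 -> C / (1 + y) < eps).
{ intros y C Hy HC; apply Rmult_lt_reg_r with (1 + y); [lra |].
  unfold Rdiv; rewrite Rmult_assoc, Rinv_l, Rmult_1_r by lra.
  assert (N * eps = C1 + C2) by (unfold N; field; lra). nra. }
(* A prefactor below 1/2 lets two errors below eps add up to less than eps. *)
assert (Hk : 0 < / (2 * PI) < / 2).
{ split; [apply Rinv_0_lt_compat; lra |].
  apply Rinv_lt_contravar; pose proof PI2_1; nra. }
apply Filter_prod with (fun a => a < - N) (fun b => N < b);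
  [exists (- N); auto | exists N; auto |].
intros a b Ha' Hb'.
set (ya := RInt (fun w => fst (K_integrand a0 a1 g x t w)) a b).
set (yb := RInt (fun w => snd (K_integrand a0 a1 g x t w)) a b).
assert (Ea : ya = / (2 * PI) * (RInt (ray (r * c) g s 0) 0 (- a) + RInt (ray (r * c) g s 0) 0 b)).
{ unfold ya.
  rewrite <- (RInt_Chasles (fun w => fst (K_integrand a0 a1 g x t w)) a 0 b)
    by (apply ex_RInt_cont; intros; apply continuous_K_fst; lra).
  replace a with (- - a) at 1 by ring.
  rewrite RInt_even, !RInt_K_fst_pos by
    (lra || (intros; apply continuous_K_fst; lra) || (intros; now rewrite K_integrand_opp)).
  symmetry; apply Rmult_plus_distr_l. }
assert (Eb : yb = / (2 * PI) * (RInt (ray_im (r * c) g s 0) 0 b - RInt (ray_im (r * c) g s 0) 0 (- a))).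
{ unfold yb.
  rewrite <- (RInt_Chasles (fun w => snd (K_integrand a0 a1 g x t w)) a 0 b)
    by (apply ex_RInt_cont; intros; apply continuous_K_snd; lra).
  replace a with (- - a) at 1 by ring.
  rewrite RInt_odd, !RInt_K_snd_pos by
    (lra || (intros; apply continuous_K_snd; lra) || (intros; now rewrite K_integrand_opp)).
  fold r c s; unfold plus; simpl; ring. }
exists (ya, yb); split.
{ apply is_RInt_fct_extend_pair;
  apply (RInt_correct (V := R_CompleteNormedModule)), ex_RInt_cont; intros;
  [apply continuous_K_fst | apply continuous_K_snd]; lra. }
assert (Hmin : N < Rmin (- a) b) by (apply Rmin_glb_lt; lra).
specialize (Him (- a) b ltac:(lra) ltac:(lra)).
assert (G1 := H1 (- a) ltac:(lra)); assert (G2 := H1 b ltac:(lra)).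
pose proof (Hfar (- a) C1 ltac:(lra) ltac:(lra)).
pose proof (Hfar b C1 ltac:(lra) ltac:(lra)).
pose proof (Hfar (Rmin (- a) b) C2 Hmin ltac:(lra)).
apply HP; split; unfold ball; simpl; unfold AbsRing_ball, abs, minus, plus, opp; simpl;
  rewrite Ropp_0, Rplus_0_r, ?Ea, ?Eb, Rabs_mult, Rabs_pos_eq by lra.
- eapply Rle_lt_trans; [apply Rmult_le_compat_l; [lra | apply Rabs_triang] |]. nra.
- eapply Rle_lt_trans; [apply Rmult_le_compat_l; [lra | exact Him] |].
  assert (0 < C2 / (1 + Rmin (- a) b)) by (apply Rdiv_lt_0_compat; lra). nra.
Qed.

(** * Prescribing the rescaled time, and non-causality for g > 1 *)

(** The scale l = (u / sg)^(1 / (1 - g)) makes l^(1 - g) sg equal to u; its base must be positive,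
    so u and sg share their sign. *)
Lemma causal_limit_rescaled a0 a1 g : 0 < g -> g <> 1 -> K_causal a0 a1 g ->
  forall sg u, sg < - a1 -> 0 < u / sg ->
  forall eps, 0 < eps -> exists N, forall M, N < M ->
    Rabs (RInt (ray (a0 / cos (PI * g / 2)) g u 0) 0 M) < eps.
Proof.
intros Hg Hg1 HK sg u Hsg Hu eps Heps.
(* Division by 0 yields 0, so [0 < u / sg] excludes [sg = 0]. *)
assert (Hsg0 : sg <> 0).
{ intros ->; unfold Rdiv in Hu; rewrite Rinv_0, Rmult_0_r in Hu; lra. }
destruct (causal_limit a0 a1 g Hg HK (Rpower (u / sg) (/ (1 - g))) sg
            (exp_pos _) Hsg eps Heps) as [N HN].
exists N; intros M HM; specialize (HN M HM).
rewrite Rpower_mult, Rinv_l, Rpower_1 in HN by lra.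
now replace (u / sg * sg) with u in HN by (field; lra).
Qed.

(** [up] gives k in (g/2 - 1/2, g/2 + 1/2]; the right end would mean g = 2 k - 1, an integer.
    Strictness keeps the cosine of PI g / 2 - k PI positive. *)
Lemma half_index g : 1 < g -> (forall n : nat, g <> INR n) ->
  exists k : Z, - / 2 < g / 2 - IZR k < / 2 /\ 0 < IZR k < g.
Proof.
intros Hg Hn.
destruct (archimed (g / 2 - / 2)) as [H1 H2].
set (k := up (g / 2 - / 2)) in *.
exists k.
assert (g / 2 - IZR k <> - / 2).
{ intros E; apply (Hn (Z.to_nat (2 * k - 1))).
  assert (0 < 2 * k - 1)%Z by (apply lt_IZR; rewrite minus_IZR, mult_IZR; lra).
  rewrite INR_IZR_INZ, Z2Nat.id by lia.
  rewrite minus_IZR, mult_IZR; lra. }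
lra.
Qed.

Lemma cos_lipschitz x y : Rabs (cos x - cos y) <= Rabs (x - y).
Proof.
destruct (MVT_gen cos y x (fun z => - sin z)) as [z [_ E]].
- intros; apply is_derive_Reals, derivable_pt_lim_cos.
- intros; apply continuity_cos.
- rewrite E, Rabs_mult, Rabs_Ropp.
  assert (Rabs (sin z) <= 1) by (apply Rabs_le, SIN_bound).
  pose proof (Rabs_pos (x - y)); nra.
Qed.

(** On the real axis u enters only through the phase - u w, so the integrands differ by at most |u|
    w times the modulus. Uniformity in M allows u to be fixed before M. *)
Lemma ray_0_lipschitz b g c : 0 < b -> 0 < g -> c * cos (PI * g / 2) = b ->
  exists C, 0 < C /\ forall u M, 0 <= M ->
    Rabs (RInt (ray c g u 0) 0 M - RInt (ray c g 0 0) 0 M) <= Rabs u * C.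
Proof.
intros Hb Hg E.
destruct (ray_0_decay b g 0 c Hb Hg E) as [C [HC H]].
exists C; split; [exact HC |]; intros u M HM.
destruct (Req_dec u 0) as [-> | Hu].
{ rewrite Rminus_diag, Rabs_R0; lra. }
assert (Hu' := Rabs_pos_lt u Hu).
assert (Hcu := fun s v => continuous_ray c g s 0 v Hg).
replace (RInt (ray c g u 0) 0 M - RInt (ray c g 0 0) 0 M)
  with (RInt (fun v => minus (ray c g u 0 v) (ray c g 0 0 v)) 0 M)
  by (apply (RInt_minus (V := R_CompleteNormedModule)); now apply ex_RInt_cont).
replace (Rabs u * C) with (Rabs u * C / (1 + 0)) by field.
apply RInt_decay; [nra | lra | |].
- intros v; apply (continuous_minus (ray c g u 0) (ray c g 0 0)); apply Hcu.
- intros v Hv; change (Rabs (ray c g u 0 v - ray c g 0 0 v) <= Rabs u * C / (1 + v) ^ 2).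
  assert (Em : ray_mod c g u 0 v = ray_mod c g 0 0 v)
    by (unfold ray_mod; rewrite sin_0; ring).
  unfold ray; rewrite Em.
  replace (exp (ray_mod c g 0 0 v) * cos (ray_arg c g u 0 v) -
    exp (ray_mod c g 0 0 v) * cos (ray_arg c g 0 0 v))
    with (exp (ray_mod c g 0 0 v) * (cos (ray_arg c g u 0 v) - cos (ray_arg c g 0 0 v))) by ring.
  rewrite Rabs_mult, Rabs_pos_eq by apply Rlt_le, exp_pos.
  assert (HL := cos_lipschitz (ray_arg c g u 0 v) (ray_arg c g 0 0 v)).
  replace (ray_arg c g u 0 v - ray_arg c g 0 0 v) with (- u * v) in HL
    by (unfold ray_arg; rewrite cos_0; ring).
  rewrite Rabs_mult, Rabs_Ropp, (Rabs_pos_eq v) in HL by exact Hv.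
  specialize (H v Hv); destruct (weight_decay C v HC Hv) as [_ [Hw _]].
  pose proof (exp_pos (ray_mod c g 0 0 v)).
  apply Rle_trans with (C / (1 + v) ^ 3 * (Rabs u * v)).
  + apply Rmult_le_compat; [lra | apply Rabs_pos | exact H | exact HL].
  + replace (Rabs u * C / (1 + v) ^ 2) with (Rabs u * (C / (1 + v) ^ 2)) by (field; lra).
    replace (C / (1 + v) ^ 3 * (Rabs u * v)) with (Rabs u * (v * (C / (1 + v) ^ 3))) by ring.
    apply Rmult_le_compat_l; lra.
Qed.

(* The kernel at the arrival point [t = |x| a1] is a positive multiple of
   [sin (k pi / g)], [k] being the integer nearest to [g / 2]: on the ray of
   angle [pi / 2 - k pi / g] the exponent is real and negative. *)
Lemma ray_0_origin_pos a0 g : 0 < a0 -> 1 < g -> (forall n : nat, g <> INR n) ->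
  cos (PI * g / 2) <> 0 /\
  exists m N, 0 < m /\ forall M, N < M ->
    m <= RInt (ray (a0 / cos (PI * g / 2)) g 0 0) 0 M.
Proof.
intros Ha Hg Hn; pose proof PI_RGT_0 as HPI.
destruct (half_index g Hg Hn) as [k [Hk1 Hk2]].
set (kp := IZR k * PI).
assert (Hskp : sin kp = 0) by (apply sin_eq_0_1; now exists k).
(* The sign (-1)^k: a shift by k PI reduces PI g / 2 to [ph0] in (- PI / 2, PI / 2), where the
   cosine is positive. *)
set (e := cos kp).
assert (He : e * e = 1).
{ pose proof (sin2_cos2 kp) as H; rewrite Hskp in H; unfold Rsqr in H.
  fold e in H; lra. }
assert (Hshift : forall y, cos (y - kp) = e * cos y)
  by (intros; rewrite cos_minus, Hskp; unfold e; ring).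
set (ph0 := PI * g / 2 - kp).
assert (Hph0 : - (PI / 2) < ph0 < PI / 2) by (unfold ph0, kp; nra).
assert (Hcph0 : 0 < cos ph0) by (apply cos_gt_0; lra).
assert (Ecos : cos (PI * g / 2) = e * cos ph0).
{ unfold ph0; rewrite Hshift, <- Rmult_assoc, He; ring. }
assert (He0 : e <> 0) by nra.
split; [rewrite Ecos; now apply Rmult_integral_contrapositive_currified; lra |].
set (c := a0 / cos (PI * g / 2)).
(* The positive decay rate on the rotated ray, where the modulus is exp (- q w^g). *)
set (q := a0 / cos ph0).
assert (Hq : 0 < q) by (apply Rdiv_lt_0_compat; lra).
assert (Hcq : c * e = q) by (unfold c, q; rewrite Ecos; field; lra).
assert (Hqa : q * cos ph0 = a0) by (unfold q; field; lra).
set (th := PI / 2 - kp / g).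
assert (Egth : g * th = ph0) by (unfold th, ph0; field; lra).
assert (Hkg : 0 < kp / g < PI).
{ split; [apply Rdiv_lt_0_compat; unfold kp; nra |].
  apply Rmult_lt_reg_r with g; [lra |].
  unfold Rdiv; rewrite Rmult_assoc, Rinv_l by lra; unfold kp; nra. }
assert (Hcth : 0 < cos th) by (apply cos_gt_0; unfold th; lra).
destruct (stretched_exp_decay a0 g Ha ltac:(lra)) as [C [HC HCd]].
(* Here cos th = sin (k PI / g); m bounds the integrand from below on [0, 1], where w^g <= 1. *)
set (m := exp (- q) * cos th).
assert (Hm : 0 < m) by (apply Rmult_lt_0_compat; [apply exp_pos | exact Hcth]).
pose proof (Rabs_pos th) as Hth0.
(* The summand 1 puts [0, 1] inside [0, M]; the other makes the arc error at most m / 2. *)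
exists (m / 2), (1 + 2 * (Rabs th * C) / m); split; [lra |]; intros M HM.
assert (HM1 : 1 < M).
{ assert (0 <= 2 * (Rabs th * C) / m) by
    (apply Rmult_le_pos; [nra | apply Rlt_le, Rinv_0_lt_compat; lra]). lra. }
assert (Hlow : m <= RInt (ray c g 0 th) 0 M).
{ assert (Hray : forall w, ray c g 0 th w = exp (- q * abspow w g) * cos th).
  { intros w; unfold ray, ray_mod, ray_arg.
    replace (g * (th - PI / 2)) with (- kp) by (unfold th; field; lra).
    rewrite cos_neg, sin_neg, Hskp; fold e; rewrite <- Hcq.
    f_equal; f_equal; ring. }
  assert (Hex : forall a b, ex_RInt (ray c g 0 th) a b)
    by (intros; apply ex_RInt_cont; intros; apply continuous_ray; lra).
  rewrite <- (RInt_Chasles (ray c g 0 th) 0 1 M) by apply Hex.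
  unfold plus; simpl.
  assert (0 <= RInt (ray c g 0 th) 1 M).
  { apply RInt_ge_0; [lra | apply Hex |].
    intros w _; rewrite Hray; apply Rmult_le_pos; [apply Rlt_le, exp_pos | lra]. }
  assert (m <= RInt (ray c g 0 th) 0 1).
  { replace m with (RInt (fun _ => m) 0 1).
    - apply RInt_le; [lra | apply ex_RInt_const | apply Hex |].
      intros w Hw; rewrite Hray; unfold m.
      apply Rmult_le_compat_r; [lra |].
      assert (Hp : abspow w g <= 1)
        by (rewrite <- (abspow_1 g); apply abspow_le; lra).
      assert (Hle : - q <= - q * abspow w g) by nra.
      now apply exp_le.
    - rewrite RInt_const; unfold scal; simpl; unfold mult; simpl; ring. }
  lra. }
assert (Hrot := ray_rotation c g 0 0 th M (C / (1 + M) ^ 3) ltac:(lra) ltac:(lra)).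
rewrite Rminus_0_r in Hrot.
assert (Hpre : forall th', Rmin 0 th <= th' <= Rmax 0 th ->
  exp (ray_mod c g 0 th' M) <= C / (1 + M) ^ 3).
{ intros th' Hth'.
  eapply Rle_trans; [| apply (HCd M ltac:(lra))].
  assert (Hle : ray_mod c g 0 th' M <= - a0 * abspow M g).
  { unfold ray_mod.
    replace (g * (th' - PI / 2)) with ((g * th' - ph0) - kp) by (unfold ph0; field).
    rewrite Hshift.
    (* Between the two rays g th' - ph0 stays between - ph0 and 0. *)
    assert (Hc : cos ph0 <= cos (g * th' - ph0)).
    { rewrite <- Egth in *.
      revert Hth'; unfold Rmin, Rmax; destruct (Rle_dec 0 th); intros Hth'.
      - rewrite <- (cos_neg (g * th' - g * th)); apply cos_decr_1; nra.
      - rewrite <- (cos_neg (g * th)); apply cos_decr_1; nra. }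
    pose proof (abspow_ge0 M g).
    replace (- c * abspow M g * (e * cos (g * th' - ph0)) + 0 * M * sin th')
      with (- (c * e) * (abspow M g * cos (g * th' - ph0))) by ring.
    rewrite Hcq, <- Hqa.
    replace (- (q * cos ph0) * abspow M g) with (- q * (abspow M g * cos ph0)) by ring.
    apply Rmult_le_compat_neg_l; [lra |].
    now apply Rmult_le_compat_l. }
  now apply exp_le. }
specialize (Hrot Hpre).
destruct (weight_decay C M HC ltac:(lra)) as [_ [_ Hw]].
assert (Herr : Rabs th * (M * (C / (1 + M) ^ 3)) <= m / 2).
{ apply Rle_trans with (Rabs th * (C / (1 + M))).
  - apply Rmult_le_compat_l; lra.
  - apply Rmult_le_reg_r with (1 + M); [lra |].
    replace (Rabs th * (C / (1 + M)) * (1 + M)) with (Rabs th * C) by (field; lra).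
    apply Rmult_lt_compat_r with (r := m) in HM; [| lra].
    replace ((1 + 2 * (Rabs th * C) / m) * m) with (m + 2 * (Rabs th * C)) in HM
      by (field; lra).
    nra. }
assert (Hab := Rle_abs (RInt (ray c g 0 th) 0 M - RInt (ray c g 0 0) 0 M)).
lra.
Qed.

Lemma not_causal_gt1 a0 a1 g : 0 < a0 -> 1 < g -> (forall n : nat, g <> INR n) ->
  ~ K_causal a0 a1 g.
Proof.
intros Ha Hg Hn HK.
destruct (ray_0_origin_pos a0 g Ha Hg Hn) as [Hcos [m [N [Hm HN]]]].
set (c := a0 / cos (PI * g / 2)) in *.
assert (E : c * cos (PI * g / 2) = a0) by (unfold c; field; exact Hcos).
destruct (ray_0_lipschitz a0 g c Ha ltac:(lra) E) as [C [HC HL]].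
(* This u costs m / 4 in the Lipschitz bound, leaving at least 3 m / 4, while causality forces less
   than m / 4. The slope - (|a1| + 1) used below is negative like u and lies below - a1. *)
set (u := - (m / (4 * C))).
assert (Hu : 0 < m / (4 * C)) by (apply Rdiv_lt_0_compat; lra).
pose proof (Rabs_pos a1) as H0; pose proof (Rle_abs a1) as H1.
destruct (causal_limit_rescaled a0 a1 g ltac:(lra) ltac:(lra) HK (- (Rabs a1 + 1)) u
  ltac:(lra)) with (eps := m / 4) as [N' HN'].
- unfold u, Rdiv; rewrite Rinv_opp, Rmult_opp_opp.
  apply Rmult_lt_0_compat; [exact Hu | apply Rinv_0_lt_compat; lra].
- lra.
- set (M := 1 + Rmax 0 (Rmax N N')).
  pose proof (Rmax_l 0 (Rmax N N')); pose proof (Rmax_r 0 (Rmax N N')).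
  pose proof (Rmax_l N N'); pose proof (Rmax_r N N').
  specialize (HN M ltac:(unfold M; lra)); specialize (HN' M ltac:(unfold M; lra)).
  specialize (HL u M ltac:(unfold M; lra)).
  unfold u in HL at 2; rewrite Rabs_Ropp, (Rabs_pos_eq (m / (4 * C))) in HL by lra.
  replace (m / (4 * C) * C) with (m / 4) in HL by (field; lra).
  fold c in HN'.
  apply Rabs_def2 in HN'; apply Rabs_le_between in HL; lra.
Qed.

(** * Positivity of Laplace integrals, and necessity of a1 >= 0 for g < 1 *)

(** On [0, v0/2] the integral is at least e^(- u v0 / 2) times a fixed positive mass, on [v0/2, v0]
    it is nonnegative, and the tail beyond v0 is of order e^(- u v0), negligible for large u. *)
Lemma laplace_eventually_pos (h : R -> R) v0 A B : 0 < v0 -> 0 < A ->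
  (forall v, continuous h v) -> (forall v, 0 < v < v0 -> 0 < h v) ->
  (forall v, 0 <= v -> Rabs (h v) <= A * exp (B * v)) ->
  exists u0, forall u, u0 <= u -> exists m, 0 < m /\
    forall M, v0 <= M -> m <= RInt (fun v => exp (- u * v) * h v) 0 M.
Proof.
intros Hv0 HA Hc Hpos Hbd.
set (H := RInt h 0 (v0 / 2)).
assert (HH : 0 < H) by (apply RInt_gt_0; [lra | intros; apply Hpos; lra | auto]).
(* With this D the tail bound A e^((B - u) v0) equals [D * ev] times half the main term [ev * H]. *)
set (D := 2 * (A * exp (B * v0)) / H).
assert (HD : 0 < D).
{ apply Rdiv_lt_0_compat; [| exact HH].
  pose proof (exp_pos (B * v0)); nra. }
(* The first bound makes the factor A / (u - B) of the primitive at most A; the second gives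
   [D * ev <= 1] through e^y >= 1 + y. *)
exists (Rmax (B + 1) (D * 2 / v0)); intros u Hu.
assert (HuB : B + 1 <= u) by (eapply Rle_trans; [apply Rmax_l | exact Hu]).
assert (HuD : D * 2 / v0 <= u) by (eapply Rle_trans; [apply Rmax_r | exact Hu]).
assert (Hu0 : 0 < u).
{ eapply Rlt_le_trans; [| exact HuD]. apply Rdiv_lt_0_compat; lra. }
set (ev := exp (- u * (v0 / 2))).
assert (Hev : 0 < ev) by apply exp_pos.
assert (HDev : D * ev <= 1).
{ assert (D <= u * (v0 / 2)).
  { apply Rmult_le_compat_r with (r := v0 / 2) in HuD; [| lra].
    now replace (D * 2 / v0 * (v0 / 2)) with D in HuD by (field; lra). }
  pose proof (exp_ineq1_le (u * (v0 / 2))).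
  assert (Einv : exp (u * (v0 / 2)) * ev = 1).
  { unfold ev; rewrite <- exp_plus, <- exp_0; f_equal; ring. }
  nra. }
exists (ev * H / 2); split; [nra |]; intros M HM.
assert (Hcf : forall v, continuous (fun v => exp (- u * v) * h v) v).
{ intros v; apply (continuous_mult (fun v => exp (- u * v)) h); [cont | apply Hc]. }
assert (Hex : forall a b, ex_RInt (fun v => exp (- u * v) * h v) a b)
  by (intros; now apply ex_RInt_cont).
rewrite <- (RInt_Chasles _ 0 (v0 / 2) M) by apply Hex.
rewrite <- (RInt_Chasles _ (v0 / 2) v0 M) by apply Hex.
unfold plus; simpl.
assert (I1 : ev * H <= RInt (fun v => exp (- u * v) * h v) 0 (v0 / 2)).
{ unfold H; change (ev * RInt h 0 (v0 / 2)) with (scal ev (RInt h 0 (v0 / 2))).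
  rewrite <- (RInt_scal h) by now apply ex_RInt_cont.
  apply RInt_le; [lra | | apply Hex |].
  - apply (ex_RInt_scal h); now apply ex_RInt_cont.
  - intros v Hv; apply Rmult_le_compat_r; [left; apply Hpos; lra |].
    apply exp_le; nra. }
assert (I2 : 0 <= RInt (fun v => exp (- u * v) * h v) (v0 / 2) v0).
{ apply RInt_ge_0; [lra | apply Hex |].
  intros v Hv; apply Rmult_le_pos; [apply Rlt_le, exp_pos | left; apply Hpos; lra]. }
assert (I3 : - (ev * H / 2) <= RInt (fun v => exp (- u * v) * h v) v0 M).
{ set (k := u - B).
  assert (Hk : 1 <= k) by (unfold k; lra).
  assert (Hprim : is_RInt (fun v => - A * exp (- k * v)) v0 M
     (minus (A / k * exp (- k * M)) (A / k * exp (- k * v0)))).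
  { apply (is_RInt_derive (fun v => A / k * exp (- k * v))).
    - intros v _; auto_derive; [exact I | field; lra].
    - intros v _; apply (ex_derive_continuous (fun v => - A * exp (- k * v))).
      auto_derive; exact I. }
  apply Rle_trans with (RInt (fun v => - A * exp (- k * v)) v0 M).
  - rewrite (is_RInt_unique (V := R_CompleteNormedModule) _ _ _ _ Hprim).
    unfold minus, plus, opp; simpl.
    assert (0 < / k <= 1).
    { split; [apply Rinv_0_lt_compat; lra |].
      rewrite <- Rinv_1; apply Rinv_le_contravar; lra. }
    assert (HAk : 0 < A / k <= A) by (unfold Rdiv; split; nra).
    pose proof (exp_pos (- k * M)); pose proof (exp_pos (- k * v0)).
    assert (E : A * exp (- k * v0) = D * ev * (ev * H / 2)).
    { unfold D, ev, k.
      replace (- (u - B) * v0) with (B * v0 + (- u * (v0 / 2) + - u * (v0 / 2))) by field.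
      rewrite !exp_plus; field; lra. }
    assert (0 < ev * H / 2) by nra.
    assert (A * exp (- k * v0) <= ev * H / 2) by (rewrite E; nra).
    assert (A / k * exp (- k * v0) <= A * exp (- k * v0)) by (apply Rmult_le_compat_r; lra).
    assert (0 < A / k * exp (- k * M)) by nra.
    lra.
  - apply RInt_le; [lra | eexists; exact Hprim | apply Hex |].
    intros v Hv.
    assert (Hb := Hbd v ltac:(lra)); apply Rabs_le_between in Hb.
    replace (- k * v) with (- u * v + B * v) by (unfold k; ring).
    rewrite exp_plus; pose proof (exp_pos (- u * v)); nra. }
lra.
Qed.

Lemma abspow_le_id v g : 0 < g < 1 -> 1 <= v -> abspow v g <= v.
Proof.
intros Hg Hv; rewrite abspow_pos by lra.
rewrite <- (Rpower_1 v) at 2 by lra; apply Rle_Rpower; lra.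
Qed.

(* For [u] large the ray may be turned clockwise onto the negative imaginary
   axis: close to the real axis the fractional power provides the decay, and
   away from it [exp (- i z u)] dominates the fractional power. *)
Lemma ray_clockwise c g : 0 < c -> 0 < g < 1 ->
  exists u0, forall u, u0 <= u -> exists C, 0 < C /\ forall M, 1 <= M ->
    Rabs (RInt (ray c g u (- (PI / 2))) 0 M - RInt (ray c g u 0) 0 M) <= C / (1 + M).
Proof.
intros Hc Hg; pose proof PI_RGT_0 as HPI.
(* Then g (PI / 2 + d) = PI / 2 (1 - (1 - g)^2) < PI / 2, so for th in [- d, 0] the cosine in the
   modulus is at least [cos ang], which is positive. *)
set (d := PI / 2 * (1 - g)).
assert (Hd : 0 < d < PI / 2).
{ unfold d; split; [apply Rmult_lt_0_compat; lra | nra]. }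
assert (Hsd : 0 < sin d) by (apply sin_gt_0; lra).
set (ang := g * (PI / 2 + d)).
assert (Hang : 0 < ang < PI / 2).
{ unfold ang; split; [apply Rmult_lt_0_compat; lra | unfold d].
  assert (g * (2 - g) < 1) by (pose proof (pow2_gt_0 (1 - g) ltac:(lra)); nra).
  replace (g * (PI / 2 + PI / 2 * (1 - g))) with (PI / 2 * (g * (2 - g))) by field.
  nra. }
assert (Hca : 0 < cos ang) by (apply cos_gt_0; lra).
assert (Hcc : 0 < c * cos ang) by nra.
destruct (stretched_exp_decay _ g Hcc (proj1 Hg)) as [C1 [HC1 H1]].
destruct (stretched_exp_decay 1 1) as [C2 [HC2 H2]]; try lra.
(* For th below - d, u sin d >= c + 1 beats c M^g <= c M by M, which leaves e^(- M). *)
exists (Rmax 0 ((c + 1) / sin d)); intros u Hu.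
assert (Hu0 : 0 <= u) by (eapply Rle_trans; [apply Rmax_l | exact Hu]).
assert (Hud : c + 1 <= u * sin d).
{ assert (Hu' : (c + 1) / sin d <= u) by (eapply Rle_trans; [apply Rmax_r | exact Hu]).
  apply Rmult_le_compat_r with (r := sin d) in Hu'; [| lra].
  now replace ((c + 1) / sin d * sin d) with (c + 1) in Hu' by (field; lra). }
exists (PI / 2 * (C1 + C2)); split; [nra |]; intros M HM.
assert (Hpow : 0 < (1 + M) ^ 3) by (apply pow_lt; lra).
assert (Hrot := ray_rotation c g u 0 (- (PI / 2)) M ((C1 + C2) / (1 + M) ^ 3)
   (proj1 Hg) ltac:(lra)).
rewrite Rminus_0_r, Rabs_Ropp, (Rabs_pos_eq (PI / 2)) in Hrot by lra.
eapply Rle_trans; [apply Hrot |].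
- intros th; rewrite Rmin_right, Rmax_left by lra; intros Hth.
  assert (Hp := abspow_ge0 M g); assert (HpM := abspow_le_id M g Hg HM).
  assert (P1 : 0 < C1 / (1 + M) ^ 3) by now apply Rdiv_lt_0_compat.
  assert (P2 : 0 < C2 / (1 + M) ^ 3) by now apply Rdiv_lt_0_compat.
  replace ((C1 + C2) / (1 + M) ^ 3) with (C1 / (1 + M) ^ 3 + C2 / (1 + M) ^ 3)
    by (field; lra).
  assert (Hs0 : 0 <= sin (- th)) by (apply sin_ge_0; lra).
  rewrite sin_neg in Hs0.
  destruct (Rle_lt_dec (- d) th) as [Hd' | Hd'].
  + assert (Hle : ray_mod c g u th M <= - (c * cos ang) * abspow M g).
    { unfold ray_mod.
      assert (cos ang <= cos (g * (th - PI / 2))).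
      { rewrite <- (cos_neg (g * (th - PI / 2))); unfold ang; apply cos_decr_1;
        fold ang; try nra; unfold ang; nra. }
      assert (0 <= u * M) by nra.
      assert (u * M * sin th <= 0) by nra.
      assert (0 <= c * abspow M g) by nra.
      nra. }
    apply exp_le in Hle; specialize (H1 M ltac:(lra)); lra.
  + assert (Hle : ray_mod c g u th M <= - (1) * abspow M 1).
    { unfold ray_mod; rewrite (abspow_pos M 1), Rpower_1 by lra.
      assert (Hsin : sin d <= - sin th).
      { rewrite <- sin_neg; apply sin_incr_1; lra. }
      pose proof (COS_bound (g * (th - PI / 2))) as Hcb.
      assert (0 <= c * abspow M g <= c * M) by (split; [nra | apply Rmult_le_compat_l; lra]).
      assert (- c * abspow M g * cos (g * (th - PI / 2)) <= c * M) by nra.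
      assert (0 <= u * M) by nra.
      assert (u * M * sin th <= - (u * M) * sin d) by nra.
      assert ((c + 1) * M <= u * sin d * M) by nra.
      nra. }
    apply exp_le in Hle; specialize (H2 M ltac:(lra)); lra.
- destruct (weight_decay (C1 + C2) M ltac:(lra) ltac:(lra)) as [_ [_ Hw]].
  replace (PI / 2 * (C1 + C2) / (1 + M)) with (PI / 2 * ((C1 + C2) / (1 + M)))
    by (field; lra).
  apply Rmult_le_compat_l; lra.
Qed.

(** If a1 < 0, causality makes the real-axis integrals small, hence also those on the negative
    imaginary axis, which are Laplace integrals of [h] bounded below by a positive constant. *)
Lemma nonneg_of_causal a0 a1 g : 0 < a0 -> 0 < g < 1 -> K_causal a0 a1 g -> 0 <= a1.
Proof.
intros Ha Hg HK; destruct (Rle_lt_dec 0 a1) as [| Ha1]; [assumption | exfalso].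
pose proof PI_RGT_0 as HPI; pose proof (cos_half_pos g Hg) as Hcos.
set (c := a0 / cos (PI * g / 2)).
assert (Hc : 0 < c) by now apply Rdiv_lt_0_compat.
set (h := fun v => exp (- c * abspow v g * cos (PI * g)) * sin (c * sin (PI * g) * abspow v g)).
assert (Hsg : 0 < sin (PI * g)) by (apply sin_gt_0; nra).
set (q := c * sin (PI * g)).
assert (Hq : 0 < q) by (apply Rmult_lt_0_compat; assumption).
assert (Hray : forall u v, ray c g u (- (PI / 2)) v = exp (- u * v) * h v).
{ intros u v; unfold ray, ray_mod, ray_arg, h.
  replace (g * (- (PI / 2) - PI / 2)) with (- (PI * g)) by field.
  rewrite !cos_neg, !sin_neg, sin_PI2, cos_PI2.
  replace (- c * abspow v g * - sin (PI * g) - u * v * 0 + - (PI / 2))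
    with (- (PI / 2 - c * sin (PI * g) * abspow v g)) by ring.
  rewrite cos_neg, cos_shift.
  rewrite <- Rmult_assoc, <- exp_plus; f_equal; f_equal; ring. }
(* The first positive zero of [h]: q v0^g = PI. *)
set (v0 := Rpower (PI / q) (/ g)).
assert (Hv0 : 0 < v0) by apply exp_pos.
assert (Ev0 : abspow v0 g = PI / q).
{ rewrite abspow_pos by exact Hv0; unfold v0.
  rewrite Rpower_mult, Rinv_l, Rpower_1; [reflexivity | now apply Rdiv_lt_0_compat | lra]. }
destruct (laplace_eventually_pos h v0 (exp c) c Hv0 (exp_pos c)) as [u1 Hu1].
- intros v; unfold h; cont; lra.
- intros v Hv; unfold h; apply Rmult_lt_0_compat; [apply exp_pos |].
  fold q.
  assert (Hp : 0 < abspow v g) by (rewrite abspow_pos by lra; apply exp_pos).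
  assert (Hlt : abspow v g < abspow v0 g)
    by (rewrite !abspow_pos by lra; apply Rlt_Rpower_l; lra).
  rewrite Ev0 in Hlt.
  apply sin_gt_0; [nra |].
  apply Rmult_lt_compat_l with (r := q) in Hlt; [| lra].
  now replace (q * (PI / q)) with PI in Hlt by (field; lra).
- intros v Hv; unfold h.
  rewrite Rabs_mult, Rabs_pos_eq by apply Rlt_le, exp_pos.
  rewrite <- exp_plus.
  assert (Hp : abspow v g <= 1 + v).
  { destruct (Rle_lt_dec 1 v).
    - pose proof (abspow_le_id v g Hg ltac:(lra)); lra.
    - assert (abspow v g <= abspow 1 g) by (apply abspow_le; lra).
      rewrite abspow_1 in *; lra. }
  pose proof (abspow_ge0 v g) as Hp0.
  assert (Hle : - c * abspow v g * cos (PI * g) <= c + c * v).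
  { pose proof (COS_bound (PI * g)).
    assert (0 <= c * abspow v g <= c * (1 + v)) by nra. nra. }
  apply exp_le in Hle.
  set (S := sin _).
  assert (Rabs S <= 1) by (apply Rabs_le, SIN_bound).
  pose proof (Rabs_pos S); pose proof (exp_pos (- c * abspow v g * cos (PI * g))).
  nra.
- destruct (ray_clockwise c g Hc Hg) as [u2 Hu2].
  set (u := 1 + Rmax 0 (Rmax u1 u2)).
  pose proof (Rmax_l 0 (Rmax u1 u2)); pose proof (Rmax_r 0 (Rmax u1 u2)).
  pose proof (Rmax_l u1 u2); pose proof (Rmax_r u1 u2).
  destruct (Hu1 u ltac:(unfold u; lra)) as [m [Hm Hm']].
  destruct (Hu2 u ltac:(unfold u; lra)) as [C [HC HC']].
  (* As a1 < 0, the slope - a1 / 2 is positive and below - a1, which admits u > 0. *)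
  destruct (causal_limit_rescaled a0 a1 g (proj1 Hg) ltac:(lra) HK (- a1 / 2) u
    ltac:(lra)) with (eps := m / 2) as [N HN].
  + apply Rdiv_lt_0_compat; unfold u; lra.
  + lra.
  + assert (HCm : 0 < 2 * C / m) by (apply Rdiv_lt_0_compat; lra).
    (* The term 2 C / m brings the rotation error below m / 2; with the real-axis integral below m /
       2 this contradicts the lower bound m. *)
    set (M := 1 + 2 * C / m + v0 + Rmax 0 N).
    pose proof (Rmax_l 0 N); pose proof (Rmax_r 0 N).
    specialize (HN M ltac:(unfold M; lra)).
    specialize (Hm' M ltac:(unfold M; lra)).
    specialize (HC' M ltac:(unfold M; lra)).
    fold c in HN.
    rewrite (RInt_ext _ (fun v => exp (- u * v) * h v)) in HC'
      by (intros; apply Hray).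
    assert (C / (1 + M) < m / 2).
    { assert (HMC : 2 * C / m < 1 + M) by (unfold M; lra).
      apply Rmult_lt_compat_r with (r := m) in HMC; [| lra].
      replace (2 * C / m * m) with (2 * C) in HMC by (field; lra).
      apply Rmult_lt_reg_r with (1 + M); [unfold M; lra |].
      unfold Rdiv at 1; rewrite Rmult_assoc, Rinv_l, Rmult_1_r by (unfold M; lra).
      lra. }
    apply Rabs_def2 in HN; apply Rabs_le_between in HC'; lra.
Qed.

Theorem theorem3 (a0 a1 g : R) (ha0 : 0 < a0) (hg : 0 < g)
  (hgN : forall n : nat, g <> INR n) :
  (1 < g -> ~ K_causal a0 a1 g) /\
  (g < 1 -> (K_causal a0 a1 g <-> 0 <= a1)).
Proof.
split; intros Hg1; [now apply not_causal_gt1 |]; split; intros H.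
- now apply (nonneg_of_causal a0 a1 g).
- now apply causal_of_nonneg.
Qed.
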